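(* Let $\theta\in(0,1)$ and $\nu>1/6$. There is a constant $C_{\nu,\theta}>0$ depending only on $\nu$ and $\theta$ such that for all $u,v\in H^1_0(\mathcal U)$ $$\big\langle u-v,\;B(u)-B(v)+f(u)-f(v)\big\rangle\le\frac12\|u-v\|_{\dot H^1}^2+C_{\nu,\theta}\|u-v\|^2.$$
   Context: $\mathcal U=(0,1)$; $\langle\cdot,\cdot\rangle$ and $\|\cdot\|$ are the inner product and norm of $L^2(\mathcal U)$ (real-valued functions). $H_0^1(\mathcal U)$ is the Sobolev space with zero boundary values, and $\|w\|_{\dot H^1}=\|A^{1/2}w\|=\|w'\|$, where $A=-\frac{d^2}{dx^2}$ is the Dirichlet operator with domain $H^2(\mathcal U)\cap H_0^1(\mathcal U)$. $f(u)(x)=\nu u(x)(1-u(x))(u(x)-\theta)$, and for $u\in H^1_0(\mathcal U)$, $B(u)(x)=u(x)u'(x)$. *)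

(* Defs.v *)
From HB Require Import structures.
From mathcomp Require Import all_boot all_order all_algebra.
From mathcomp Require Import all_classical all_reals all_analysis.

Set Implicit Arguments.
Unset Strict Implicit.
Unset Printing Implicit Defensive.

Import Order.TTheory GRing.Theory Num.Theory.
Import numFieldNormedType.Exports.

Local Open Scope classical_set_scope.
Local Open Scope ring_scope.

(* A function on U = ]0, 1[ is represented by any function R -> R; only its
   values (almost everywhere) on U are ever used. *)
Definition U01 {R : realType} : set R := `]0, 1[.

Definition L2 {R : realType} (u : R -> R) : Prop :=
  u \_ U01 \in Lfun lebesgue_measure 2%:E.

Definition inner {R : realType} (u v : R -> R) : R :=
  \int[lebesgue_measure]_(x in U01) (u x * v x).

Definition L2norm {R : realType} (u : R -> R) : R := Num.sqrt (inner u u).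

(* C^1_c(U), each element being extended by 0 to the whole line. *)
Definition C1c {R : realType} (phi : R -> R) : Prop :=
  [/\ forall x : R, derivable phi x 1,
      continuous (derive1 phi),
      compact (closure [set x | phi x != 0]) &
      closure [set x | phi x != 0] `<=` U01].

(* Sobolev spaces on an interval, in the form of Brezis, "Functional Analysis,
   Sobolev Spaces and Partial Differential Equations", Sections 8.2 and 8.3:
   test functions are in C^1_c(U), and H^1_0(U) is the closure of C^1_c(U)
   in H^1(U). *)
Definition is_weak_deriv {R : realType} (u g : R -> R) : Prop :=
  L2 g /\ forall phi : R -> R, C1c phi -> inner u (derive1 phi) = - inner g phi.

Definition H1 {R : realType} (u : R -> R) : Prop :=
  L2 u /\ exists g : R -> R, is_weak_deriv u g.

(* A representative of u' for u in H1 (it is unique up to equality a.e. on U);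
   the zero function if u has no weak derivative in L^2(U). *)
Definition weak_deriv {R : realType} (u : R -> R) : R -> R :=
  xget (cst 0) [set g | is_weak_deriv u g].

Definition H1norm {R : realType} (u : R -> R) : R :=
  Num.sqrt (L2norm u ^+ 2 + L2norm (weak_deriv u) ^+ 2).

Definition H10 {R : realType} (u : R -> R) : Prop :=
  H1 u /\ forall e : R, 0 < e ->
    exists2 phi : R -> R, C1c phi & H1norm (u - phi) < e.

(* The norm |A^{1/2} w| = |w'| of the form domain of A = - d^2/dx^2 with
   Dirichlet boundary conditions. *)
Definition dotH1norm {R : realType} (w : R -> R) : R := L2norm (weak_deriv w).

Definition reaction {R : realType} (nu theta : R) (u : R -> R) : R -> R :=
  fun x => nu * u x * (1 - u x) * (u x - theta).

Definition burgers {R : realType} (u : R -> R) : R -> R :=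
  fun x => u x * weak_deriv u x.

(* Main.v *)
Require Import Defs.
From mathcomp Require Import all_boot all_order all_algebra.
From mathcomp Require Import all_classical all_reals all_analysis.
From mathcomp Require Import measurable_realfun.
From mathcomp Require Import ring lra.

Import Order.TTheory GRing.Theory Num.Theory.
Import numFieldNormedType.Exports.

Local Open Scope classical_set_scope.
Local Open Scope ring_scope.

(** Write w = u - v and s = u + v, and let w', s' be their weak derivatives.
The two nonlinearities are polynomial, and in these variables
  u u' - v v' = (s w' + w s') / 2   and   f(u) - f(v) = w Q,
where Q = nu ((1 + theta) s - (3 s^2 + w^2) / 4 - theta).  Since w^2 s vanishes
at both ends of the interval, the integral of (w^2 s)' = 2 w w' s + w^2 s' is
zero, so the Burgers part of the left-hand side is - <w', w s> / 2.  Young's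
inequality bounds it by |w'|^2 / 2 plus the integral of w^2 s^2 / 8, and what
remains is the integral of w^2 (Q + s^2 / 8).  The coefficient of s^2 in the last
factor is 1/8 - 3 nu / 4, which is negative exactly when nu > 1/6; hence the
factor is bounded above by a constant ([slope_bound]), which is C.

The rest justifies this computation for functions of H^1_0, which are given
only up to null sets and whose derivatives are only weak.

A test function phi is the primitive of its derivative, so its supremum is at
most the L^2 norm of phi' ([C1c_sup_le]), which in turn is at most the norm of any
weak derivative of phi ([derive1_C1c_le]).  Through Chebyshev's inequality the
bound passes to H^1_0, whose elements are therefore essentially bounded
([in_H10_Linfty]), and every product occurring above is integrable.

For two test functions phi, psi and c in H^1_0, the product phi psi is again a
test function, so the definition of c' gives
<c, (phi psi)'> = - <c', phi psi>.  Both sides are continuous in phi and psi for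
the H^1 norm once everything is bounded, which yields the trilinear identity
<a', b c> + <b', a c> + <c', a b> = 0 on H^1_0 ([in_H10_trilinear]).

The weak derivative of a function is an unspecified representative, and that of
u - v is not given as the difference of those of u and v.  Two weak derivatives
of one function differ by some g orthogonal to all test functions; it is enough
that such a g is also orthogonal to derivatives of test functions
([orthC1c_derive1]) and to products of elements of H^1_0 ([orthC1c_mul]). *)

(** * Square-integrable and essentially bounded functions on the unit interval *)

Lemma measurable_U01 {R : realType} : measurable (@U01 R).
Proof. exact: measurable_itv. Qed.
#[local] Hint Extern 0 (measurable U01) => exact: measurable_U01 : core.

Section L2_theory.
Context {R : realType}.
Implicit Types a b c f : R -> R.
Notation mu := (@lebesgue_measure R).
Notation U := (@U01 R).

Lemma measure_U01 : mu U = 1%E.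
Proof. by rewrite /U01 lebesgue_measure_itv/= lte_fin ltr01 oppr0 adde0. Qed.

(** Square-integrability is defined through the extension by zero to the line; this
form stays on the interval, over which all the integrals below are taken. *)
Lemma L2P a : L2 a <->
  measurable_fun U a /\ mu.-integrable U (EFin \o (fun x => a x ^+ 2)).
Proof.
have sqE : (EFin \o (fun x => a x ^+ 2)) \_ U =
    EFin \o (fun x => (a \_ U) x ^+ 2).
  apply/funext => x; rewrite /patch /=; case: ifPn => //= _.
  by rewrite expr0n.
have intE : mu.-integrable U (EFin \o (fun x => a x ^+ 2)) <->
    mu.-integrable setT (EFin \o (fun x => (a \_ U) x ^+ 2)).
  by rewrite -sqE; exact: integrable_mkcond.
split.
  move=> a2; split.
    apply/(measurable_restrictT _ measurable_U01).
    by move: a2; rewrite /L2 inE => /andP[]; rewrite inE.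
  by apply/intE; exact: Lfun2_integrable_sqr.
move=> [ma ia]; rewrite /L2 inE; apply/andP; split.
  by rewrite inE/=; apply/(measurable_restrictT _ measurable_U01).
rewrite inE/= /finite_norm unlock /Lnorm poweR_lty//.
move/intE : ia => /integrableP[_].
apply: le_lt_trans; rewrite le_eqVlt; apply/orP; left; apply/eqP.
apply: eq_integral => x _ /=.
by rewrite [`|_ ^+ 2|]ger0_norm ?sqr_ge0// powR_mulrn// real_normK// num_real.
Qed.

Lemma L2_measurable {a} : L2 a -> measurable_fun U a.
Proof. by move=> /L2P[]. Qed.

Lemma L2_integrableM {a b} : L2 a -> L2 b ->
  mu.-integrable U (EFin \o (fun x => a x * b x)).
Proof.
move=> /L2P[ma ia] /L2P[mb ib].
apply: (@le_integrable _ _ _ mu _ measurable_U01 _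
  ((EFin \o (fun x => (a x ^+ 2)%R)) \+ (EFin \o (fun x => (b x ^+ 2)%R)))%E).
- by apply/measurable_EFinP; exact: measurable_funM.
- move=> x _ /=; rewrite lee_fin [leRHS]ger0_norm ?addr_ge0 ?sqr_ge0//.
  by rewrite ler_norml; apply/andP; split; nra.
- exact: integrableD.
Qed.

Lemma L2D {a b} : L2 a -> L2 b -> L2 (a + b).
Proof.
move=> a2 b2; have [ma ia] := (L2P a).1 a2; have [mb ib] := (L2P b).1 b2.
apply/L2P; split; first exact: measurable_funD.
rewrite [X in mu.-integrable _ X](_ : _ =
  ((EFin \o (fun x => (a x ^+ 2)%R)) \+ ((EFin \o (fun x => (b x ^+ 2)%R))
    \+ ((EFin \o (fun x => (a x * b x)%R)) \+ (EFin \o (fun x => (a x * b x)%R)))))%E).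
  by apply: integrableD => //; apply: integrableD => //; apply: integrableD => //;
    exact: L2_integrableM.
by apply/funext => x /=; rewrite -!EFinD; congr EFin; rewrite fctE; ring.
Qed.

Lemma inner_ge0 a : 0 <= inner a a.
Proof. by apply: Rintegral_ge0 => x _; rewrite -expr2 sqr_ge0. Qed.

Lemma L2norm_ge0 a : 0 <= L2norm a.
Proof. exact: sqrtr_ge0. Qed.

Lemma sqr_L2norm a : L2norm a ^+ 2 = inner a a.
Proof. by rewrite sqr_sqrtr// inner_ge0. Qed.

Lemma innerC a b : inner a b = inner b a.
Proof. by apply: eq_Rintegral => x _; rewrite mulrC. Qed.

Lemma innerMA a b c : inner (a * b) c = inner a (b * c).
Proof. by apply: eq_Rintegral => x _; rewrite !fctE mulrA. Qed.

Lemma innerDl a b c : L2 a -> L2 b -> L2 c ->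
  inner (a + b) c = inner a c + inner b c.
Proof.
move=> a2 b2 c2; rewrite /inner -RintegralD//; [|exact: L2_integrableM..].
by apply: eq_Rintegral => x _; rewrite fctE mulrDl.
Qed.

Lemma innerZl k a c : L2 a -> L2 c -> inner (cst k * a) c = k * inner a c.
Proof.
move=> a2 c2; rewrite /inner -RintegralZl//; last exact: L2_integrableM.
by apply: eq_Rintegral => x _; rewrite !fctE mulrA.
Qed.

#[local] Instance ae_lebesgue_filter : Filter (nbhs (almost_everywhere mu)).
Proof. exact: ae_filter_ringOfSetsType. Qed.

(** The multipliers of L^2: [L2M] is the reason for introducing them. The bound
is left existential because only the finiteness of integrals depends on it. *)
Definition Linfty b :=
  measurable_fun U b /\ exists M, {ae mu, forall x, U x -> `|b x| <= M}.

Lemma Linfty_cst k : Linfty (cst k).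
Proof. by split => //; exists `|k|; apply: aeW => x _. Qed.

Lemma LinftyD {a b} : Linfty a -> Linfty b -> Linfty (a + b).
Proof.
move=> [ma [M aM]] [mb [N bN]]; split; first exact: measurable_funD.
exists (M + N); move: aM bN; apply: filterS2 => x aM bN Ux.
by rewrite fctE (le_trans (ler_normD _ _))// lerD ?aM ?bN.
Qed.

Lemma LinftyM {a b} : Linfty a -> Linfty b -> Linfty (a * b).
Proof.
move=> [ma [M aM]] [mb [N bN]]; split; first exact: measurable_funM.
exists (M * N); move: aM bN; apply: filterS2 => x aM bN Ux.
by rewrite fctE normrM ler_pM ?aM ?bN.
Qed.

Lemma L2M {a b} : Linfty b -> L2 a -> L2 (b * a).
Proof.
move=> [mb [M bM]] /L2P[ma ia]; apply/L2P; split; first exact: measurable_funM.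
have iM : mu.-integrable U (fun x => (M ^+ 2)%:E * (EFin \o (fun x => (a x ^+ 2)%R)) x)%E.
  exact: integrableZl.
have mba : measurable_fun U (EFin \o (fun x => (b * a) x ^+ 2)).
  by apply/measurable_EFinP; apply: measurable_funX; exact: measurable_funM.
apply/integrableP; split => //.
move/integrableP : iM => [mM]; apply: le_lt_trans.
apply: ae_ge0_le_integral => //.
- exact: measurableT_comp.
- exact: measurableT_comp.
move: bM; apply: filterS => x bM Ux.
rewrite lee_fin mulrfctE -exprMn !normrX ler_sqr ?nnegrE// !normrM.
by rewrite ler_wpM2r// (le_trans (bM Ux))// ler_norm.
Qed.

Lemma L2_Linfty {b} : Linfty b -> L2 b.
Proof.
move=> bi; rewrite -(mulr1 b); apply: L2M => //; apply/L2P; split.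
  exact: measurable_cst.
rewrite (_ : _ \o _ = EFin \o cst 1); last first.
  by apply/funext => x; rewrite /= expr1n.
apply: measurable_bounded_integrable => //.
  exact: (eq_ind_r (fun z => (z < +oo)%E) (ltry 1) measure_U01).
by exists 1; split => // M M1 x _ /=; rewrite normr1 ltW.
Qed.

Lemma L2Z k {a} : L2 a -> L2 (cst k * a).
Proof. exact/L2M/Linfty_cst. Qed.

Lemma L2N {a} : L2 a -> L2 (- a).
Proof.
move=> a2; rewrite (_ : - a = cst (-1) * a); first exact: L2Z.
by apply/funext => x; rewrite !fctE mulN1r.
Qed.

Lemma L2B {a b} : L2 a -> L2 b -> L2 (a - b).
Proof. by move=> a2 b2; apply: L2D => //; exact: L2N. Qed.

Lemma innerNl a c : L2 a -> L2 c -> inner (- a) c = - inner a c.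
Proof.
move=> a2 c2; rewrite -[RHS]mulN1r -innerZl//; apply: eq_Rintegral => x _.
by rewrite !fctE !mulN1r.
Qed.

Lemma innerBl a b c : L2 a -> L2 b -> L2 c ->
  inner (a - b) c = inner a c - inner b c.
Proof.
by move=> a2 b2 c2; rewrite innerDl ?innerNl//; exact: L2N.
Qed.

Lemma innerDr a b c : L2 a -> L2 b -> L2 c ->
  inner a (b + c) = inner a b + inner a c.
Proof. by move=> a2 b2 c2; rewrite innerC innerDl// !(innerC a). Qed.

Lemma innerBr a b c : L2 a -> L2 b -> L2 c ->
  inner a (b - c) = inner a b - inner a c.
Proof. by move=> a2 b2 c2; rewrite innerC innerBl// !(innerC a). Qed.

Lemma innerZr k a c : L2 a -> L2 c -> inner a (cst k * c) = k * inner a c.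
Proof. by move=> a2 c2; rewrite innerC innerZl// innerC. Qed.

Lemma L2norm0 : L2norm (0 : R -> R) = 0.
Proof.
rewrite /L2norm /inner; under eq_Rintegral do rewrite mulr0.
by rewrite Rintegral_cst// mul0r sqrtr0.
Qed.

Lemma L2normN a : L2norm (- a) = L2norm a.
Proof.
by congr Num.sqrt; apply: eq_Rintegral => x _; rewrite !fctE mulrNN.
Qed.

(** The quadratic t |-> |a - t b|^2 is nonnegative; evaluate it at its minimum. *)
Lemma cauchy_schwarz a b : L2 a -> L2 b ->
  `|inner a b| <= L2norm a * L2norm b.
Proof.
move=> a2 b2.
have P t : 0 <= inner a a - 2 * t * inner a b + t ^+ 2 * inner b b.
  have tb2 := L2Z t b2; have atb2 := L2B a2 tb2.
  have := inner_ge0 (a - cst t * b).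
  rewrite innerBl// !innerBr// !innerZl// !innerZr// (innerC b a).
  by move=> h; apply: (le_trans h); rewrite le_eqVlt; apply/orP; left; apply/eqP; ring.
rewrite -(@ler_pXn2r _ 2)// ?nnegrE ?mulr_ge0 ?L2norm_ge0//.
rewrite exprMn !sqr_L2norm real_normK ?num_real//.
have := inner_ge0 b; rewrite le_eqVlt => /predU1P[b0|b0].
  suff -> : inner a b = 0 by rewrite expr0n -b0 mulr0.
  apply/eqP; apply: contraT => ab0.
  (* If |b| = 0 the quadratic is affine in t, so it must be constant: at this t it
     would be equal to -1. *)
  have := P ((inner a a + 1) / (2 * inner a b)); rewrite -b0 mulr0 addr0.
  have -> : 2 * ((inner a a + 1) / (2 * inner a b)) * inner a b = inner a a + 1.
    by field.
  by lra.
have := P (inner a b / inner b b).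
have -> : inner a a - 2 * (inner a b / inner b b) * inner a b +
  (inner a b / inner b b) ^+ 2 * inner b b =
  (inner a a * inner b b - inner a b ^+ 2) / inner b b by field; exact: lt0r_neq0.
by rewrite pmulr_lge0 ?invr_gt0// subr_ge0.
Qed.

Lemma ler_L2normD a b : L2 a -> L2 b -> L2norm (a + b) <= L2norm a + L2norm b.
Proof.
move=> a2 b2.
rewrite -(@ler_pXn2r _ 2)// ?nnegrE ?addr_ge0 ?L2norm_ge0//.
rewrite sqr_L2norm sqrrD !sqr_L2norm innerDl ?innerDr//; last exact: L2D.
have := le_trans (ler_norm _) (cauchy_schwarz _ _ a2 b2).
rewrite (innerC b a) -mulr_natr; lra.
Qed.

End L2_theory.

(** * Continuously differentiable functions and test functions *)

Section C1c_theory.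
Context {R : realType}.
Implicit Types a b c f g h phi psi : R -> R.
Notation mu := (@lebesgue_measure R).
Notation U := (@U01 R).

Definition C1 f := (forall x : R, derivable f x 1) /\ continuous (derive1 f).

Lemma C1_continuous f : C1 f -> continuous f.
Proof.
by move=> [df _] x; apply: differentiable_continuous; exact/derivable1_diffP.
Qed.

Lemma C1_is_derive f : C1 f -> forall x : R, is_derive x 1 f (derive1 f x).
Proof. by move=> [df _] x; rewrite derive1E; exact: derivableP. Qed.

Lemma is_derive_C1 f g : (forall x : R, is_derive x 1 f (g x)) -> continuous g ->
  C1 f /\ derive1 f = g.
Proof.
move=> dfg cg; have fg : derive1 f = g.
  by apply/funext => x; rewrite derive1E; exact: derive_val.
by split => //; split; [move=> x; exact: ex_derive|rewrite fg].
Qed.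

Lemma C1M f g : C1 f -> C1 g ->
  C1 (f * g) /\ derive1 (f * g) = f * derive1 g + derive1 f * g.
Proof.
move=> Cf Cg; apply: is_derive_C1.
  move=> x; have df := C1_is_derive f Cf x; have dg := C1_is_derive g Cg x.
  by apply: is_derive_eq; rewrite !fctE /GRing.scale/= [X in _ + X]mulrC.
have cf := C1_continuous f Cf; have cg := C1_continuous g Cg.
move=> x; apply: continuousD; apply: continuousM.
- exact: cf.
- exact: Cg.2.
- exact: Cf.2.
- exact: cg.
Qed.

Lemma C1_shift f t : C1 f -> C1 (f \o (fun x => x + t)).
Proof.
move=> Cf; apply: (proj1 (is_derive_C1 _ (derive1 f \o (fun x => x + t)) _ _)).
  move=> x; have df := C1_is_derive f Cf (x + t).
  have ds : is_derive x (1 : R) (fun x => x + t) 1.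
    by apply: is_derive_eq; rewrite addr0.
  by have := @is_derive1_comp _ f (fun x => x + t) x _ _ df ds; rewrite mulr1.
move=> x; apply: continuous_comp; last exact: Cf.2.
by apply: cvgD; [exact: cvg_id|exact: cvg_cst].
Qed.

Lemma C1_diff_quot f k t : C1 f -> C1 (fun x => k * (f (x + t) - f x)).
Proof.
move=> Cf; have Cft := C1_shift f t Cf.
apply: (proj1 (is_derive_C1 _
  (fun x => k * (derive1 (f \o (fun x => x + t)) x - derive1 f x)) _ _)).
  move=> x; have df := C1_is_derive f Cf x; have dft := C1_is_derive _ Cft x.
  by apply: is_derive_eq; rewrite /GRing.scale/=.
move=> x; apply: cvgM; first exact: cvg_cst.
by apply: cvgB; [exact: Cft.2|exact: Cf.2].
Qed.

(** Test functions vanish outside a compact interval that stays away from 0 and 1;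
in this form, supports of products, sums and translates are immediate. *)
Lemma C1cP phi : C1c phi <-> C1 phi /\
  exists p q : R, [/\ 0 < p, q < 1 & forall x, phi x != 0 -> p <= x <= q].
Proof.
split=> [[dphi cphi Ksupp KU]|[[dphi cphi] [p [q [p0 q1 pq]]]]].
  split=> //; set K := closure _ in Ksupp KU.
  have cid : {within K, continuous (id : R -> R)}.
    by apply: continuous_subspaceT => x; exact: cvg_id.
  have phiK x : phi x != 0 -> K x by move=> ?; exact: subset_closure.
  have [K0|/set0P/negP/negbNE/eqP K0] := pselect (K !=set0); last first.
    exists (1 / 2), (1 / 2); split; [lra|lra|].
    by move=> x /phiK; rewrite K0.
  have [p pK pmin] := compact_EVT_min K0 Ksupp cid.
  have [q qK qmax] := compact_EVT_max K0 Ksupp cid.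
  exists p, q; split.
  - by have := KU p (set_mem pK); rewrite /U01/= in_itv/= => /andP[].
  - by have := KU q (set_mem qK); rewrite /U01/= in_itv/= => /andP[].
  - by move=> x /phiK Kx; rewrite (pmin x (mem_set Kx)) (qmax x (mem_set Kx)).
have sub : closure [set x | phi x != 0] `<=` `[p, q].
  rewrite [X in _ `<=` X](closure_id _).1; last exact: itv_closed.
  by apply: closureS => x /= /pq; rewrite in_itv.
split => //.
  apply: subclosed_compact sub; [exact: closed_closure|exact: segment_compact].
move=> x /sub; rewrite /U01 /= !in_itv/= => /andP[px xq].
by rewrite (lt_le_trans p0 px) (le_lt_trans xq q1).
Qed.

Lemma C1c_C1 {phi} : C1c phi -> C1 phi.
Proof. by move/C1cP => []. Qed.

Lemma C1c_out {phi x} : C1c phi -> ~ U x -> phi x = 0.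
Proof.
move/C1cP => [_ [p [q [p0 q1 pq]]]] Ux; apply/eqP; apply: contra_notT Ux => /pq.
rewrite /U01/= in_itv/= => /andP[px xq].
by rewrite (lt_le_trans p0 px) (le_lt_trans xq q1).
Qed.

Lemma C1cN phi : C1c phi -> C1c (- phi).
Proof.
move=> /C1cP[Cphi [p [q [p0 q1 pq]]]]; apply/C1cP; split.
  apply: (proj1 (is_derive_C1 _ (- derive1 phi) _ _)).
    by move=> x; have df := C1_is_derive _ Cphi x; exact: is_derive_eq.
  by move=> x; apply: cvgN; exact: Cphi.2.
by exists p, q; split => // x; rewrite fctE oppr_eq0 => /pq.
Qed.

Lemma C1cD phi psi : C1c phi -> C1c psi -> C1c (phi + psi).
Proof.
move=> /C1cP[Cphi [p [q [p0 q1 pq]]]] /C1cP[Cpsi [p' [q' [p'0 q'1 pq']]]].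
apply/C1cP; split.
  apply: (proj1 (is_derive_C1 _ (derive1 phi + derive1 psi) _ _)).
    move=> x; have df := C1_is_derive _ Cphi x; have dg := C1_is_derive _ Cpsi x.
    exact: is_derive_eq.
  by move=> x; apply: cvgD; [exact: Cphi.2|exact: Cpsi.2].
exists (Num.min p p'), (Num.max q q'); split.
- by rewrite lt_min p0.
- by rewrite gt_max q1.
- move=> x; rewrite ge_min le_max fctE.
  have [->|/pq/andP[-> ->]//] := eqVneq (phi x) 0.
  by rewrite add0r => /pq'/andP[-> ->]; rewrite !orbT.
Qed.

Lemma C1cM phi psi : C1c phi -> C1c psi -> C1c (phi * psi).
Proof.
move=> /C1cP[Cphi [p [q [p0 q1 pq]]]] /C1c_C1 Cpsi; apply/C1cP; split.
  exact: (C1M _ _ Cphi Cpsi).1.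
exists p, q; split => // x /=; rewrite mulf_eq0 negb_or => /andP[/pq]//.
Qed.

(** Moving a test function by less than the distance of its support to the boundary
keeps it a test function, so its difference quotients are test functions. *)
Lemma C1c_diff_quot phi : C1c phi ->
  exists2 r : R, 0 < r <= 1 & forall k t : R, 0 <= t <= r ->
    C1c (fun x => k * (phi (x + t) - phi x)).
Proof.
move=> /C1cP[Cphi [p [q [p0 q1 pq]]]].
exists (Num.min 1 (p / 2)).
  by rewrite lt_min ltr01 divr_gt0//= ge_min lexx.
move=> k t; rewrite le_min => /and3P[t0 _ tp]; apply/C1cP; split.
  exact: C1_diff_quot.
exists (p / 2), q; split => [|//|x]; first by lra.
have [->|/pq] := eqVneq (phi x) 0; last by move=> /andP[? ?] _; apply/andP; lra.
have [->|/pq /andP[? ?] _] := eqVneq (phi (x + t)) 0; last by apply/andP; lra.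
by rewrite subr0 mulr0 eqxx.
Qed.

Lemma continuous_bounded_itv f (p q : R) : continuous f ->
  exists2 M : R, 0 <= M & forall x, p <= x <= q -> `|f x| <= M.
Proof.
move=> cf; have cK : compact (f @` `[p, q]).
  by apply: continuous_compact; [exact: continuous_subspaceT|exact: segment_compact].
have [M [Mr bM]] := compact_bounded cK.
exists (`|M| + 1); first by rewrite addr_ge0.
move=> x pxq; apply: bM; first by rewrite (le_lt_trans (ler_norm _))// ltrDl.
by exists x => //=; rewrite in_itv.
Qed.

Lemma continuous_Linfty f : continuous f -> Linfty f.
Proof.
move=> cf; split.
  by apply: measurable_funTS; exact: continuous_measurable_fun.
have [M _ bM] := continuous_bounded_itv f 0 1 cf; exists M; apply: aeW => x.
by rewrite /U01/= in_itv/= => /andP[/ltW x0 /ltW x1]; apply: bM; rewrite x0.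
Qed.

Lemma C1c_Linfty {phi} : C1c phi -> Linfty phi.
Proof. by move=> /C1c_C1/C1_continuous/continuous_Linfty. Qed.

Lemma derive1_C1c_Linfty {phi} : C1c phi -> Linfty (derive1 phi).
Proof. by move=> /C1c_C1[_ /continuous_Linfty]. Qed.

Lemma Rintegral_derive1 f (p q : R) : C1 f -> p < q ->
  \int[mu]_(x in `]p, q[) derive1 f x = f q - f p.
Proof.
move=> Cf pq; rewrite /Rintegral.
have cf := C1_continuous f Cf.
rewrite -(@integral_itv_bndoo _ p q _ true false); last first.
  apply/measurable_EFinP; apply: measurable_funTS.
  exact: continuous_measurable_fun Cf.2.
rewrite (@continuous_FTC2 _ (derive1 f) f)//.
- exact: continuous_subspaceT Cf.2.
- split; first by move=> x _; exact: Cf.1.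
    by apply: cvg_at_right_filter; exact: cf.
  by apply: cvg_at_left_filter; exact: cf.
Qed.

(** The product of two test functions is zero at the endpoints, so the integral of
its derivative vanishes. *)
Lemma C1c_weak_deriv {phi} : C1c phi -> is_weak_deriv phi (derive1 phi).
Proof.
move=> Cphi; split; first exact: L2_Linfty (derive1_C1c_Linfty Cphi).
move=> psi Cpsi; have [Cpp pp'] := C1M _ _ (C1c_C1 Cphi) (C1c_C1 Cpsi).
have := Rintegral_derive1 _ 0 1 Cpp ltr01.
rewrite {2 3}/GRing.mul/= !(C1c_out Cphi); [|by rewrite /U01/= in_itv/= ltxx ?andbF..].
rewrite !mul0r subrr pp' => I0.
apply/eqP; rewrite -addr_eq0; apply/eqP.
have phi2 := L2_Linfty (C1c_Linfty Cphi).
have psi2 := L2_Linfty (C1c_Linfty Cpsi).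
have dphi2 := L2_Linfty (derive1_C1c_Linfty Cphi).
have dpsi2 := L2_Linfty (derive1_C1c_Linfty Cpsi).
by rewrite -[RHS]I0 /inner -RintegralD//; exact: L2_integrableM.
Qed.

(** For x in the interval, phi x is the integral of phi' over ]0, x[ because phi
vanishes at 0; this is the inner product of phi' with an indicator function of
norm at most 1. *)
Lemma C1c_sup_le {phi} x : C1c phi -> `|phi x| <= L2norm (derive1 phi).
Proof.
move=> Cphi; have [Ux|Ux] := pselect (U x); last first.
  by rewrite (C1c_out Cphi Ux) normr0 L2norm_ge0.
have /andP[x0 x1] : 0 < x < 1 by move: Ux; rewrite /U01/= in_itv.
pose J := \1_(`]0, x[) : R -> R.
have JU : Linfty J.
  split; first by apply: measurable_funTS; exact: measurable_indic.
  exists 1; apply: aeW => y _; rewrite /J indicE ger0_norm//.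
  by case: (_ \in _).
have sub : `]0, x[ `<=` U.
  by move=> y /=; rewrite /U01/= !in_itv/= => /andP[-> /lt_trans ->].
have phiE : phi x = inner J (derive1 phi).
  have := Rintegral_derive1 _ 0 x (C1c_C1 Cphi) x0.
  rewrite (C1c_out (x := 0) Cphi) ?subr0; last by rewrite /U01/= in_itv/= ltxx.
  move=> <-; rewrite -(setIidr sub) Rintegral_mkcondr; apply: eq_Rintegral => y _.
  by rewrite /J indicE /patch; case: ifPn => _; rewrite ?mul1r ?mul0r.
have J1 : L2norm J <= 1.
  rewrite -[leRHS]sqrtr1 ler_sqrt// /inner.
  have -> : 1 = \int[mu]_(y in U) cst (1 : R) y.
    by rewrite Rintegral_cst// mul1r; exact/esym/(congr1 fine measure_U01).
  apply: le_Rintegral => //.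
  - by apply: L2_integrableM; exact: L2_Linfty.
  - have L1 : L2 (cst (1 : R)) by apply: L2_Linfty; exact: Linfty_cst.
    by have := L2_integrableM L1 L1; under eq_fun do rewrite /= mulr1.
  - by move=> y _; rewrite /J indicE; case: (_ \in _); rewrite ?mulr1 ?mulr0 ?ler01.
rewrite phiE; apply: (le_trans (cauchy_schwarz _ _ _ _)).
- exact: L2_Linfty.
- exact/L2_Linfty/derive1_C1c_Linfty.
- by rewrite ler_piMl// L2norm_ge0.
Qed.

End C1c_theory.

(** * Weak derivatives and orthogonality to test functions *)

Section weak_derivatives.
Context {R : realType}.
Implicit Types a b c f g h phi psi : R -> R.
Notation mu := (@lebesgue_measure R).
Notation U := (@U01 R).

Lemma weak_derivD a b da db : L2 a -> L2 b ->
  is_weak_deriv a da -> is_weak_deriv b db -> is_weak_deriv (a + b) (da + db).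
Proof.
move=> a2 b2 [da2 ida] [db2 idb]; split; first exact: L2D.
move=> phi Cphi; have phi2 := L2_Linfty (C1c_Linfty Cphi).
have dphi2 := L2_Linfty (derive1_C1c_Linfty Cphi).
by rewrite !innerDl// ida// idb// opprD.
Qed.

Lemma weak_derivN a da : L2 a -> is_weak_deriv a da -> is_weak_deriv (- a) (- da).
Proof.
move=> a2 [da2 ida]; split; first exact: L2N.
move=> phi Cphi; have phi2 := L2_Linfty (C1c_Linfty Cphi).
have dphi2 := L2_Linfty (derive1_C1c_Linfty Cphi).
by rewrite !innerNl// ida.
Qed.

Lemma weak_derivB a b da db : L2 a -> L2 b ->
  is_weak_deriv a da -> is_weak_deriv b db -> is_weak_deriv (a - b) (da - db).
Proof.
by move=> a2 b2 wa wb; apply: weak_derivD => //; [exact: L2N|exact: weak_derivN].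
Qed.

Lemma weak_derivP a da : is_weak_deriv a da -> is_weak_deriv a (weak_deriv a).
Proof.
move=> ada; have ex : exists g, is_weak_deriv a g by exists da.
exact: (@xgetPex _ (cst 0) [set g | is_weak_deriv a g] ex).
Qed.

(** The ambiguity in the choice of a weak derivative, see [weak_deriv_orth]. *)
Definition orthC1c g := L2 g /\ forall phi, C1c phi -> inner g phi = 0.

Lemma weak_deriv_orth a da db :
  is_weak_deriv a da -> is_weak_deriv a db -> orthC1c (da - db).
Proof.
move=> [da2 ida] [db2 idb]; split; first exact: L2B.
move=> phi Cphi; have phi2 := L2_Linfty (C1c_Linfty Cphi).
by rewrite innerBl// -[inner da _]opprK -[inner db _]opprK -ida// -idb// subrr.
Qed.

(** The derivative of a test function is the pointwise limit of its difference
quotients, which are test functions dominated by its maximal slope. *)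
Lemma orthC1c_derive1 g phi : orthC1c g -> C1c phi -> inner g (derive1 phi) = 0.
Proof.
move=> [g2 og] Cphi; have [r /andP[r0 r1] Cdq] := C1c_diff_quot phi Cphi.
pose t n : R := r * harmonic n.
have t0 n : 0 < t n by rewrite mulr_gt0// harmonic_gt0.
have tr n : t n <= r.
  by rewrite /t/= ger_pMr// invf_le1// ler1n.
pose d n := fun x => (t n)^-1 * (phi (x + t n) - phi x).
have od n : inner g (d n) = 0 by apply: og; apply: Cdq; rewrite tr ltW.
have C1phi := C1c_C1 Cphi.
(* The quotients at x in ]0, 1[ involve slopes up to x + r, and r <= 1. *)
have [M M0 bM] := continuous_bounded_itv _ 0 2 C1phi.2.
have dM n x : U x -> `|d n x| <= M.
  rewrite /U01/= in_itv/= => /andP[x0 x1].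
  have xt : x < x + t n by rewrite ltrDl.
  have [//||y] := @MVT _ phi (derive1 phi) x (x + t n) xt.
  - by move=> y _; exact: C1_is_derive.
  - exact: continuous_subspaceT (C1_continuous _ C1phi).
  rewrite in_itv/= => /andP[xy yx]; rewrite /d => ->.
  rewrite addrAC subrr add0r mulrCA mulVf ?gt_eqF// mulr1; apply: bM.
  by have := tr n; move=> ?; apply/andP; split; lra.
have t_cvg : t n @[n --> \oo] --> (0 : R).
  by rewrite -(mulr0 r); apply: cvgMr; exact: cvg_harmonic.
have d_cvg x : d n x @[n --> \oo] --> derive1 phi x.
  have dphi : (fun k : R => k^-1 *: (phi (k + x) - phi x)) @ 0^' --> derive1 phi x.
    have := C1phi.1 x; rewrite /derivable => /cvg_ex[l]/=.
    have -> : (fun k : R => k^-1 *: (phi (k *: 1 + x) - phi x)) =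
      (fun k : R => k^-1 *: (phi (k + x) - phi x)).
      by apply/funext => k; rewrite [k *: 1]mulr1.
    by move=> hl; rewrite /derive1 (cvg_lim _ hl).
  have /cvg_at_rightP := cvg_dnbhs_at_right dphi.
  move=> /(_ t (conj t0 t_cvg)); rewrite /d.
  by under [X in _ -> X @ _ --> _]eq_fun do rewrite (addrC x).
have mg := L2_measurable g2.
have iMg : mu.-integrable U (fun x => (M * `|g x|)%:E).
  have M2 : L2 (cst M : R -> R) by apply: L2_Linfty; exact: Linfty_cst.
  have := integrable_norm (L2_integrableM M2 g2).
  apply: eq_integrable => // x _ /=.
  by rewrite normrM (ger0_norm M0).
have mgd n : measurable_fun U (fun x => (g x * d n x)%:E).
  apply/measurable_EFinP; apply: measurable_funM => //.
  apply: measurable_funTS; apply: continuous_measurable_fun.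
  exact: C1_continuous (C1_diff_quot _ _ _ C1phi).
have mgd' : measurable_fun U (fun x => (g x * derive1 phi x)%:E).
  apply/measurable_EFinP; apply: measurable_funM => //.
  by apply: measurable_funTS; exact: continuous_measurable_fun C1phi.2.
have cvgd : {ae mu, forall x, U x ->
    (g x * d n x)%:E @[n --> \oo] --> (g x * derive1 phi x)%:E}.
  apply: aeW => x _; apply/fine_cvgP; split; first exact: nearW.
  have : g x * d n x @[n --> \oo] --> g x * derive1 phi x.
    by apply: cvgMr; exact: d_cvg.
  exact.
have domd : {ae mu, forall x n, U x -> (`|(g x * d n x)%:E| <= (M * `|g x|)%:E)%E}.
  by apply: aeW => x n Ux; rewrite lee_fin normrM mulrC ler_wpM2r// dM.
have [_ _] := @dominated_convergence _ _ R mu U measurable_U01 _ _ _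
  mgd mgd' cvgd iMg domd.
have ig' : mu.-integrable U (EFin \o (fun x => g x * derive1 phi x)).
  by apply: L2_integrableM => //; exact/L2_Linfty/derive1_C1c_Linfty.
have -> : (\int[mu]_(x in U) (g x * derive1 phi x)%:E = (inner g (derive1 phi))%:E)%E.
  by rewrite /inner /Rintegral fineK//; exact: integrable_fin_num ig'.
move=> /fine_cvgP[_]; rewrite (_ : fine \o _ = cst 0); last first.
  by apply/funext => n; exact: od.
by move=> h0; apply/esym; apply: (cvg_unique _ (cvg_cst _) h0); exact: Rhausdorff.
Qed.

End weak_derivatives.

(** * The closure of the test functions in H^1 *)

Section H10_pairs.
Context {R : realType}.
Implicit Types a b c f g h p q u v phi psi : R -> R.
Notation mu := (@lebesgue_measure R).
Notation U := (@U01 R).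

(** The classical derivative is the weak derivative of least norm: h - phi' is
orthogonal to phi' by [orthC1c_derive1], so |phi'|^2 = <h, phi'>. *)
Lemma derive1_C1c_le phi h : C1c phi -> is_weak_deriv phi h ->
  L2norm (derive1 phi) <= L2norm h.
Proof.
move=> Cphi wh; have wd := C1c_weak_deriv Cphi.
have := orthC1c_derive1 _ _ (weak_deriv_orth _ _ _ wh wd) Cphi.
have [h2 d2] := (wh.1, wd.1).
rewrite innerBl// => /eqP; rewrite subr_eq0 => /eqP hd.
have := le_trans (ler_norm _) (cauchy_schwarz _ _ h2 d2).
rewrite hd -sqr_L2norm expr2.
have := L2norm_ge0 (derive1 phi); rewrite le_eqVlt => /predU1P[<- _|d0].
  exact: L2norm_ge0.
by rewrite ler_pM2r.
Qed.

(** Membership in H^1_0 with a prescribed weak derivative. The approximating test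
functions also carry an arbitrary weak derivative, because the distance in H^1
is measured with unspecified representatives of the derivatives. *)
Definition in_H10 a da := [/\ L2 a, is_weak_deriv a da &
  forall e : R, 0 < e -> exists phi h, [/\ C1c phi, is_weak_deriv phi h,
    L2norm (a - phi) < e & L2norm (da - h) < e]].

Lemma C1c_in_H10 phi h : C1c phi -> is_weak_deriv phi h -> in_H10 phi h.
Proof.
move=> Cphi wh; split=> [||e e0]; [exact: L2_Linfty (C1c_Linfty Cphi)|by []|].
by exists phi, h; split => //; rewrite subrr L2norm0.
Qed.

(** If psi is the chosen derivative of u - phi, then u' - psi is a weak derivative
of phi at the required distance from u'. *)
Lemma H10_in_H10 u : H10 u -> in_H10 u (weak_deriv u).
Proof.
move=> [[u2 [g /weak_derivP wu]] approx]; split => // e /approx[phi Cphi H1e].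
have phi2 := L2_Linfty (C1c_Linfty Cphi).
have w := weak_derivP _ _ (weak_derivB _ _ _ _ u2 phi2 wu (C1c_weak_deriv Cphi)).
have up2 := L2B u2 phi2.
exists phi, (weak_deriv u - weak_deriv (u - phi)); split => //.
- have {1}-> : phi = u - (u - phi) by rewrite opprB addrC subrK.
  exact: weak_derivB.
- apply: le_lt_trans H1e; rewrite -[leLHS](ger0_norm (L2norm_ge0 _)) -sqrtr_sqr.
  by rewrite /H1norm ler_wsqrtr// lerDl sqr_ge0.
- have -> : weak_deriv u - (weak_deriv u - weak_deriv (u - phi)) = weak_deriv (u - phi).
    by rewrite opprB addrC subrK.
  apply: le_lt_trans H1e; rewrite -[leLHS](ger0_norm (L2norm_ge0 _)) -sqrtr_sqr.
  by rewrite /H1norm ler_wsqrtr// lerDr sqr_ge0.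
Qed.

Lemma in_H10D a b da db : in_H10 a da -> in_H10 b db -> in_H10 (a + b) (da + db).
Proof.
move=> [a2 wa aP] [b2 wb bP]; split; [exact: L2D|exact: weak_derivD|].
move=> e e0; have e20 : 0 < e / 2 by rewrite divr_gt0.
have [phi [h [Cphi wh ap dh]]] := aP _ e20.
have [psi [k [Cpsi wk bp dk]]] := bP _ e20.
have phi2 := L2_Linfty (C1c_Linfty Cphi).
have psi2 := L2_Linfty (C1c_Linfty Cpsi).
exists (phi + psi), (h + k); split; [exact: C1cD|exact: weak_derivD|..].
- rewrite opprD addrACA (le_lt_trans (ler_L2normD _ _ _ _))//; [exact: L2B..|].
  by rewrite [ltRHS]splitr ltrD.
- rewrite opprD addrACA (le_lt_trans (ler_L2normD _ _ _ _))//.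
  + exact: L2B wa.1 wh.1.
  + exact: L2B wb.1 wk.1.
  + by rewrite [ltRHS]splitr ltrD.
Qed.

Lemma in_H10N a da : in_H10 a da -> in_H10 (- a) (- da).
Proof.
move=> [a2 wa aP]; split; [exact: L2N|exact: weak_derivN|].
move=> e /aP[phi [h [Cphi wh ap dh]]].
exists (- phi), (- h); split; [exact: C1cN| |by rewrite -opprD L2normN..].
by apply: weak_derivN => //; exact: L2_Linfty (C1c_Linfty Cphi).
Qed.

Lemma in_H10B a b da db : in_H10 a da -> in_H10 b db -> in_H10 (a - b) (da - db).
Proof. by move=> aP bP; apply: in_H10D => //; exact: in_H10N. Qed.

(** The approximating test functions are uniformly bounded by M = |a'| + 1. Where
|a| >= M + 1, each of them is at distance at least 1 from a, so by Chebyshev's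
inequality this set has measure at most |a - phi|^2, which is arbitrarily small. *)
Lemma in_H10_Linfty {a da} : in_H10 a da -> Linfty a.
Proof.
move=> [a2 [da2 _] aP]; split; first exact: L2_measurable.
pose M := L2norm da + 1.
have approx (e : R) : 0 < e -> exists2 phi, L2 phi /\ (forall x, `|phi x| <= M) &
    L2norm (a - phi) < e.
  move=> e0; have m0 : 0 < Num.min 1 e by rewrite lt_min ltr01.
  have [phi [h [Cphi wh]]] := aP _ m0; rewrite !lt_min => /andP[_ aphi] /andP[dah _].
  exists phi => //; split=> [|x]; first exact: L2_Linfty (C1c_Linfty Cphi).
  apply: (le_trans (C1c_sup_le x Cphi)).
  apply: (le_trans (derive1_C1c_le _ _ Cphi wh)).
  have -> : h = da + - (da - h) by rewrite opprB addrC subrK.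
  apply: (le_trans (ler_L2normD _ _ _ _)) => //.
    by apply/L2N/L2B => //; case: wh.
  by rewrite L2normN lerD2l ltW.
have ma := L2_measurable a2.
pose S := U `&` [set x | M + 1 <= `|a x|].
have mS : measurable S.
  have mna : measurable_fun U (fun x => `|a x|) by exact: measurableT_comp.
  have := mna measurable_U01 _ (measurable_itv `[M + 1, +oo[).
  by congr measurable; apply/seteqP; split => x /=; rewrite in_itv/= andbT.
have S_le (e : R) : 0 < e -> (mu S <= e%:E)%E.
  move=> e0; have m0 : 0 < Num.min 1 e by rewrite lt_min ltr01.
  have [phi [phi2 phiM]] := approx _ m0; rewrite lt_min => /andP[l1 le].
  have d2 := L2B a2 phi2.
  have id := L2_integrableM d2 d2.
  pose G : R -> \bar R := EFin \o (fun x => (a - phi) x * (a - phi) x).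
  have mG : measurable_fun U G by exact: measurable_int id.
  have G0 x : (0 <= G x)%E by rewrite lee_fin -expr2 sqr_ge0.
  have IG : (\int[mu]_(x in U) G x)%E = (L2norm (a - phi) ^+ 2)%:E.
    by rewrite sqr_L2norm /inner /Rintegral fineK//; exact: integrable_fin_num id.
  apply: (@le_trans _ _ (\int[mu]_(x in U) G x)%E).
    have -> : mu S = (\int[mu]_(x in U) (\1_S x)%:E)%E.
      rewrite integral_indic//; congr (mu _); apply/esym/setIidl.
      exact: subIsetl.
    apply: ge0_le_integral => //.
    - by apply/measurable_EFinP; apply: measurable_funTS; exact: measurable_indic.
    move=> x _; rewrite lee_fin indicE; case: (boolP (x \in S)) => [|_].
      rewrite inE => -[_ /= Max]; rewrite fctE -expr2 -real_normK ?num_real//.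
      rewrite exprn_ege1//; have := phiM x; have := lerB_dist (a x) (phi x).
      by move=> *; lra.
    by rewrite -expr2 sqr_ge0.
  rewrite IG lee_fin; have := L2norm_ge0 (a - phi); move=> ?; nra.
have S0 : mu S = 0%E.
  apply/eqP; rewrite eq_le measure_ge0 andbT; apply/lee_addgt0Pr => e e0.
  by rewrite add0e S_le.
exists (M + 1), S; split => // x /= /not_implyP[Ux /negP].
by rewrite -ltNge => /ltW; split.
Qed.

(** A linear functional that is continuous for the H^1 norm and vanishes on test
functions vanishes on their closure. *)
Lemma in_H10_closure a da p q : in_H10 a da -> L2 p -> L2 q ->
  (forall phi h, C1c phi -> is_weak_deriv phi h -> inner phi p + inner h q = 0) ->
  inner a p + inner da q = 0.
Proof.
move=> [a2 [da2 _] aP] p2 q2 ph0; apply/eqP; rewrite -normr_le0.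
apply/ler_addgt0Pr => e e0; rewrite add0r.
have K0 : 0 < L2norm p + L2norm q + 1 by rewrite ltr_pwDr// addr_ge0 ?L2norm_ge0.
have [phi [h [Cphi wh ap dh]]] := aP _ (divr_gt0 e0 K0).
have phi2 := L2_Linfty (C1c_Linfty Cphi); have h2 := wh.1.
have -> : inner a p + inner da q = inner (a - phi) p + inner (da - h) q.
  by rewrite !innerBl// addrACA -opprD (ph0 phi h)// subr0.
apply: (le_trans (ler_normD _ _)).
have ap2 := L2B a2 phi2; have dh2 := L2B da2 h2.
apply: (le_trans (lerD (cauchy_schwarz _ _ ap2 p2) (cauchy_schwarz _ _ dh2 q2))).
have -> : e = e / (L2norm p + L2norm q + 1) * L2norm p +
  e / (L2norm p + L2norm q + 1) * L2norm q + e / (L2norm p + L2norm q + 1).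
  by field; exact: lt0r_neq0.
apply: (le_trans (lerD (ler_wpM2r (L2norm_ge0 p) (ltW ap))
  (ler_wpM2r (L2norm_ge0 q) (ltW dh)))).
by rewrite lerDl divr_ge0// ltW.
Qed.

(** Both factors are limits in L^2 of test functions, and a product of two test
functions is a test function. The factors are replaced one at a time, so that the
other one is always a bounded multiplier. *)
Lemma orthC1c_mul g a b da db : orthC1c g -> in_H10 a da -> in_H10 b db ->
  inner g (a * b) = 0.
Proof.
move=> [g2 og] aP bP; have [ai bi] := (in_H10_Linfty aP, in_H10_Linfty bP).
have z2 : L2 (cst 0 : R -> R) by apply: L2_Linfty; exact: Linfty_cst.
have z0 f : inner f (cst 0) = 0.
  by rewrite /inner; under eq_Rintegral do rewrite mulr0; rewrite Rintegral_cst// mul0r.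
have closure c dc f : in_H10 c dc -> L2 f ->
    (forall phi, C1c phi -> inner phi f = 0) -> inner c f = 0.
  move=> cP f2 f0; have := in_H10_closure _ _ _ _ cP f2 z2.
  rewrite z0 addr0; apply => phi h Cphi _.
  by rewrite z0 addr0 f0.
rewrite innerC innerMA; apply: (closure _ _ _ aP); first exact: L2M.
move=> phi Cphi; have phii := C1c_Linfty Cphi.
rewrite -innerMA [phi * b]mulrC innerMA; apply: (closure _ _ _ bP).
  exact: L2M.
move=> psi Cpsi; rewrite -innerMA innerC; apply: og; exact: C1cM.
Qed.

(** Integration of (a b c)'. With test functions phi, psi in place of a and b it is
the definition of c' tested against phi psi; then a and b are reached by
continuity, one after the other. *)
Lemma in_H10_trilinear a b c da db dc :
  in_H10 a da -> in_H10 b db -> in_H10 c dc ->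
  inner da (b * c) + inner db (a * c) + inner dc (a * b) = 0.
Proof.
move=> aP bP cP.
have ai := in_H10_Linfty aP; have bi := in_H10_Linfty bP.
have ci := in_H10_Linfty cP; have c2 := L2_Linfty ci.
have da2 : L2 da by case: aP => _ [].
have dc2 : L2 dc by case: cP => _ [].
have wc : is_weak_deriv c dc by case: cP.
pose T f df g dg := inner df (g * c) + inner dg (f * c) + inner dc (f * g).
have TC f df g dg : T f df g dg = T g dg f df.
  by rewrite /T mulrC (addrC (inner df _)) [f * g]mulrC.
have test phi psi h k : C1c phi -> is_weak_deriv phi h ->
    C1c psi -> is_weak_deriv psi k -> T phi h psi k = 0.
  move=> Cphi wh Cpsi wk.
  (* The weak derivative l of eta may be replaced by the classical one here. *)
  have orth chi eta l : C1c chi -> C1c eta -> is_weak_deriv eta l ->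
      inner l (chi * c) = inner c (derive1 eta * chi).
    move=> Cchi Ceta wl; have chii := C1c_Linfty Cchi.
    have -> : inner c (derive1 eta * chi) = inner (derive1 eta) (chi * c).
      by apply: eq_Rintegral => x _; rewrite !fctE; ring.
    apply/eqP; rewrite -subr_eq0 -innerBl//; [|exact: wl.1| |exact: L2M].
      have dl := weak_deriv_orth _ _ _ wl (C1c_weak_deriv Ceta).
      have chiP := C1c_in_H10 _ _ Cchi (C1c_weak_deriv Cchi).
      exact/eqP/(orthC1c_mul _ _ _ _ _ dl chiP cP).
    exact: L2_Linfty (derive1_C1c_Linfty Ceta).
  rewrite /T (orth psi phi h)// (orth phi psi k)//.
  have phii := C1c_Linfty Cphi; have psii := C1c_Linfty Cpsi.
  have := wc.2 _ (C1cM _ _ Cphi Cpsi).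
  rewrite (C1M _ _ (C1c_C1 Cphi) (C1c_C1 Cpsi)).2 innerDr//.
  - by rewrite [phi * derive1 psi]mulrC addrC => ->; rewrite addNr.
  - exact: L2M phii (L2_Linfty (derive1_C1c_Linfty Cpsi)).
  - by rewrite mulrC; exact: L2M psii (L2_Linfty (derive1_C1c_Linfty Cphi)).
have extend f df g dg : in_H10 f df -> Linfty g -> L2 dg ->
    (forall phi h, C1c phi -> is_weak_deriv phi h -> T phi h g dg = 0) ->
    T f df g dg = 0.
  move=> fP gi dg2 test0.
  have cdg2 := L2M ci dg2; have gdc2 := L2M gi dc2.
  have gc2 := L2M gi c2.
  have TE u du : L2 u ->
      T u du g dg = inner u (c * dg + g * dc) + inner du (g * c).
    move=> u2; rewrite innerDr// addrC addrA; congr (_ + _ + _).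
      by apply: eq_Rintegral => x _; rewrite !fctE; ring.
    by apply: eq_Rintegral => x _; rewrite !fctE; ring.
  rewrite TE; last by case: fP.
  apply: in_H10_closure fP _ gc2 _; first exact: L2D.
  move=> phi h Cphi wh; rewrite -TE ?test0//.
  exact: L2_Linfty (C1c_Linfty Cphi).
have half phi h : C1c phi -> is_weak_deriv phi h -> T phi h a da = 0.
  move=> Cphi wh; rewrite TC; apply: extend => //.
  - exact: C1c_Linfty.
  - exact: wh.1.
  - by move=> psi k Cpsi wk; exact: test.
by rewrite -/(T a da b db) TC; exact: extend.
Qed.

End H10_pairs.

(** * The one-sided Lipschitz estimate *)

Section one_sided_Lipschitz.
Context {R : realType}.
Implicit Types u v w : R -> R.

(** The polynomial multiplying (u - v)^2 in the estimate, with y, z the values of u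
and v. In terms of y + z and y - z its quadratic part is
- k (y + z)^2 - nu (y - z)^2 / 4 with k = 3 nu / 4 - 1/8 > 0; completing the square
in y + z gives the constant. *)
Lemma slope_bound (theta nu : R) : 0 < theta -> 1 / 6 < nu ->
  exists2 C : R, 0 < C & forall y z : R,
    1 / 8 * (y + z) ^+ 2 +
      nu * ((1 + theta) * (y + z) - (y ^+ 2 + y * z + z ^+ 2) - theta) <= C.
Proof.
move=> theta0 nu6; pose k := 3 / 4 * nu - 1 / 8.
have k0 : 0 < k by rewrite /k; lra.
exists ((nu * (1 + theta)) ^+ 2 / (4 * k)).
  by apply: divr_gt0; [apply: exprn_gt0; apply: mulr_gt0; lra|lra].
move=> y z; rewrite ler_pdivlMr; last lra.
rewrite -subr_ge0 [leRHS](_ : _ = (nu * (1 + theta) - 2 * k * (y + z)) ^+ 2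
    + 4 * k * (nu * ((y - z) ^+ 2 / 4 + theta))); last by rewrite /k; field.
apply: addr_ge0; first exact: sqr_ge0.
have := sqr_ge0 (y - z) => yz; apply: mulr_ge0; first lra.
by apply: mulr_ge0; lra.
Qed.

(** The trilinear identity turns the Burgers term into - <w', w s> / 2, and
0 <= |w' + w s / 2|^2 is Young's inequality with the weight that produces the
coefficient 1/2 of |w'|^2. Here dw' enters the nonlinearity and dw the norm: they
are two weak derivatives of the same function. *)
Lemma energy_bound (C : R) Q w s dw dw' ds :
  Linfty Q -> Linfty w -> Linfty s -> L2 dw -> L2 dw' -> L2 ds ->
  (forall x, Q x + 1 / 8 * (s x * s x) <= C) ->
  inner dw (w * s) = inner dw' (w * s) ->
  inner dw' (w * s) + inner dw' (w * s) + inner ds (w * w) = 0 ->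
  inner w (cst (1 / 2) * (s * dw' + w * ds) + w * Q)
    <= 1 / 2 * inner dw dw + C * inner w w.
Proof.
move=> Qi wi si dw2 dw'2 ds2 QC dwE tri.
have w2 := L2_Linfty wi; have ws2 := L2_Linfty (LinftyM wi si).
have wQ2 := L2_Linfty (LinftyM wi Qi).
have wss2 := L2_Linfty (LinftyM wi (LinftyM si si)).
have sdw2 := L2M si dw'2; have wds2 := L2M wi ds2.
have sum2 := L2D sdw2 wds2; have hsum2 := L2Z (1 / 2) sum2.
have e1 : inner w (s * dw') = inner dw' (w * s) by rewrite -innerMA innerC.
have e2 : inner w (w * ds) = inner ds (w * w) by rewrite -innerMA innerC.
have -> : inner w (cst (1 / 2) * (s * dw' + w * ds) + w * Q)
    = inner w (w * Q) - 1 / 2 * inner dw (w * s).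
  by rewrite innerDr// innerZr// innerDr// e1 e2 dwE; lra.
have hws2 := L2Z (1 / 2) ws2; have dwhws2 := L2D dw2 hws2.
have sq : inner (dw + cst (1 / 2) * (w * s)) (dw + cst (1 / 2) * (w * s))
    = inner dw dw + inner dw (w * s) + 1 / 4 * inner w (w * (s * s)).
  have -> : inner w (w * (s * s)) = inner (w * s) (w * s).
    by apply: eq_Rintegral => x _; rewrite !fctE; ring.
  by rewrite innerDl// !innerDr// !innerZl// !innerZr// (innerC (w * s) dw); field.
have := inner_ge0 (dw + cst (1 / 2) * (w * s)); rewrite {}sq => sq.
have Cw2 := L2Z C w2; have ewss2 := L2Z (1 / 8) wss2; have CwQ2 := L2B Cw2 wQ2.
have : 0 <= inner w (cst C * w - w * Q - cst (1 / 8) * (w * (s * s))).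
  apply: Rintegral_ge0 => x _.
  have -> : w x * (cst C * w - w * Q - cst (1 / 8) * (w * (s * s))) x
      = w x ^+ 2 * (C - (Q x + 1 / 8 * (s x * s x))) by rewrite !fctE; ring.
  by rewrite mulr_ge0 ?sqr_ge0// subr_ge0.
rewrite !innerBr// !innerZr//; lra.
Qed.

(** The derivative dw of u - v is independent of du and dv. It is exchanged with
du - dv in the Burgers term, where both are tested against (u - v) (u + v), a
product of two elements of H^1_0. *)
Lemma one_sided_Lipschitz (theta nu C : R) u v du dv dw :
  (forall y z : R, 1 / 8 * (y + z) ^+ 2 +
    nu * ((1 + theta) * (y + z) - (y ^+ 2 + y * z + z ^+ 2) - theta) <= C) ->
  in_H10 u du -> in_H10 v dv -> is_weak_deriv (u - v) dw ->
  inner (u - v) (u * du - v * dv + reaction nu theta u - reaction nu theta v)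
    <= 1 / 2 * inner dw dw + C * inner (u - v) (u - v).
Proof.
move=> slopeC uP vP wdw.
have wP := in_H10B _ _ _ _ uP vP; have sP := in_H10D _ _ _ _ uP vP.
have ui := in_H10_Linfty uP; have vi := in_H10_Linfty vP.
pose Q : R -> R := fun x => nu * ((1 + theta) * (u x + v x)
  - (u x ^+ 2 + u x * v x + v x ^+ 2) - theta).
have Qi : Linfty Q.
  have -> : Q = cst (- nu) * (u * u + u * v + v * v + cst theta)
      + cst (nu * (1 + theta)) * (u + v).
    by apply/funext => x; rewrite /Q !fctE; ring.
  have ci r := Linfty_cst (R := R) r.
  apply: LinftyD; last exact: (LinftyM (ci _) (LinftyD ui vi)).
  apply: (LinftyM (ci _) (LinftyD (LinftyD (LinftyD _ _) _) (ci _))).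
  - exact: (LinftyM ui ui).
  - exact: (LinftyM ui vi).
  - exact: (LinftyM vi vi).
have -> : inner (u - v) (u * du - v * dv + reaction nu theta u - reaction nu theta v)
    = inner (u - v) (cst (1 / 2) * ((u + v) * (du - dv) + (u - v) * (du + dv))
      + (u - v) * Q).
  apply: eq_Rintegral => x _; congr (_ * _).
  by rewrite /reaction /Q !fctE; field.
have QC x : Q x + 1 / 8 * ((u x + v x) * (u x + v x)) <= C.
  by have := slopeC (u x) (v x); rewrite /Q -expr2 addrC.
have wi := in_H10_Linfty wP; have si := in_H10_Linfty sP.
have w2 := L2_Linfty wi; have [dw2 du2] : L2 dw /\ L2 (du - dv).
  by split; [case: wdw|case: wP => _ []].
have ds2 : L2 (du + dv) by case: sP => _ [].
have orth : inner dw ((u - v) * (u + v)) = inner (du - dv) ((u - v) * (u + v)).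
  apply/eqP; rewrite -subr_eq0 -innerBl//; last exact: L2_Linfty (LinftyM wi si).
  have [_ wdw' _] := wP; apply/eqP.
  exact: orthC1c_mul (weak_deriv_orth _ _ _ wdw wdw') wP sP.
have := in_H10_trilinear _ _ _ _ _ _ wP wP sP.
exact: energy_bound.
Qed.

End one_sided_Lipschitz.

Theorem lemma2p1 (R : realType) (theta nu : R) :
  0 < theta < 1 -> 1 / 6 < nu ->
  exists C : R, 0 < C /\
    forall u v : R -> R, H10 u -> H10 v ->
      inner (u - v)
            (burgers u - burgers v + reaction nu theta u - reaction nu theta v)
        <= 1 / 2 * dotH1norm (u - v) ^+ 2 + C * L2norm (u - v) ^+ 2.
Proof.
move=> /andP[theta0 _] nu6; have [C C0 slopeC] := slope_bound theta nu theta0 nu6.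
exists C; split => // u v /H10_in_H10 uP /H10_in_H10 vP.
have [_ wuv _] := in_H10B _ _ _ _ uP vP.
rewrite /dotH1norm !sqr_L2norm.
exact: one_sided_Lipschitz slopeC uP vP (weak_derivP _ _ wuv).
Qed.
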